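(* Let $A = [\mathbf{a}_1,\ldots,\mathbf{a}_n] \in \mathbb{Z}_{\ge 0}^{d\times n}$ and $B = [\mathbf{b}_1,\ldots,\mathbf{b}_m]\in\mathbb{Z}_{\ge 0}^{d\times m}$ be matrices, none of whose columns $\mathbf{a}_i$, $\mathbf{b}_j$ is $\mathbf{0}\in\mathbb{Z}^d$, and suppose that $A$ and $B$ are of harmony. Let $K$ be a field, and let $K[z,\mathbf{x}] = K[z,x_1,\ldots,x_n]$ and $K[z,\mathbf{y}]=K[z,y_1,\ldots,y_m]$ be polynomial rings, where $x_i$ corresponds to the column $\mathbf{a}_i$ of $A^\sharp$, $y_j$ corresponds to the column $\mathbf{b}_j$ of $B^\sharp$, and $z$ corresponds to the column $\mathbf{0}$ of $A^\sharp$, respectively of $B^\sharp$; thus $I_{A^\sharp}\subset K[z,\mathbf{x}]$ and $I_{B^\sharp}\subset K[z,\mathbf{y}]$. Suppose that there are reverse lexicographic orders $<_A$ on $K[z,\mathbf{x}]$ and $<_B$ on $K[z,\mathbf{y}]$ such that the initial ideals $\mathrm{in}_{<_A}(I_{A^\sharp})$ and $\mathrm{in}_{<_B}(I_{B^\sharp})$ are squarefree and such that (1) for $i \neq j$, $x_i <_A x_j$ whenever $\mathbf{t}^{\mathbf{a}_i}s$ divides $\mathbf{t}^{\mathbf{a}_j}s$ (i.e. whenever $\mathbf{a}_j-\mathbf{a}_i\in\mathbb{Z}_{\ge 0}^d$); (2) $z <_A x_k$ for all $1\le k\le n$; (3) $z <_B y_k$ for all $1\le k\le m$. Let $[-B,A]$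 denote the $d\times(n+m)$ integer matrix $[-\mathbf{b}_1,\ldots,-\mathbf{b}_m,\mathbf{a}_1,\ldots,\mathbf{a}_n]$. Then the toric ideal $I_{[-B,A]^\sharp}$ of $[-B,A]^\sharp$ possesses a squarefree initial ideal with respect to a reverse lexicographic order whose smallest variable corresponds to the column $\mathbf{0}\in\mathbb{Z}^d$ of $[-B,A]^\sharp$.
   Context: Toric ideals. For an integer $d\times n$ matrix $M=[\mathbf{c}_1,\ldots,\mathbf{c}_n]$ with columns $\mathbf{c}_j=[c_{1j},\ldots,c_{dj}]^\top$ and a field $K$, the toric ideal $I_M$ is the kernel of the ring homomorphism $\pi:K[x_1,\ldots,x_n]\to K[t_1^{\pm1},\ldots,t_d^{\pm1},s]$, $\pi(x_j)=\mathbf{t}^{\mathbf{c}_j}s = t_1^{c_{1j}}\cdots t_d^{c_{dj}}s$. The variable $x_j$ is said to correspond to the column $\mathbf{c}_j$. The matrix $M^\sharp$. If no column of an integer matrix $M$ with $d$ rows is $\mathbf{0}\in\mathbb{Z}^d$, then $M^\sharp$ denotes the matrix obtained from $M$ by adding the column $\mathbf{0}\in\mathbb{Z}^d$. Reverse lexicographic order. A reverse lexicographic order is the graded reverse lexicographic monomial order induced by some total ordering of the variables: $u<v$ iff $\deg u<\deg v$, or $\deg u=\deg v$ and the smallest variable whose exponents in $u$ and $v$ differ has larger exponent in $u$. An initial ideal is squarefree if it is generated by squarefree monomials. Harmony. For $\mathbf{c}=[c_1,\ldots,c_d]^\top\in\mathbb{Z}^d$ put $\mathbf{c}^{(+)}=[\max\{0,c_i\}]_i$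 and $\mathbf{c}^{(-)}=[\max\{0,-c_i\}]_i$, so $\mathbf{c}=\mathbf{c}^{(+)}-\mathbf{c}^{(-)}$. Nonnegative integer matrices $A\in\mathbb{Z}_{\ge0}^{d\times n}$ and $B\in\mathbb{Z}_{\ge0}^{d\times m}$ with no zero columns are of harmony if for every column $\mathbf{a}$ of $A^\sharp$ and every column $\mathbf{b}$ of $B^\sharp$, setting $\mathbf{c}=\mathbf{a}-\mathbf{b}$, the vector $\mathbf{c}^{(+)}$ is a column of $A^\sharp$ and $\mathbf{c}^{(-)}$ is a column of $B^\sharp$. *)

(* Defs.v *)
From HB Require Import structures.
From mathcomp Require Export all_boot all_order all_algebra fraction.
From mathcomp.multinomials Require Export mpoly.

Set Implicit Arguments.
Unset Strict Implicit.
Unset Printing Implicit Defensive.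

Import Order.TTheory GRing.Theory Num.Theory.
Local Open Scope ring_scope.

Definition ideal_gen (R : comNzRingType) (S : R -> Prop) (f : R) : Prop :=
  exists r : seq (R * R),
    (forall p, p \in r -> S p.2) /\ f = \sum_(p <- r) p.1 * p.2.

(* The Laurent polynomial ring K[t_1^{+-1}, ..., t_d^{+-1}, s] is taken inside
   the fraction field of the polynomial ring K[t_1, ..., t_d, s]. *)
Notation laurent_field K d := {fraction {mpoly K[d + 1]}}.

Definition laurent_t (K : fieldType) (d : nat) (i : 'I_d) : laurent_field K d :=
  FracField.tofrac 'X_(lshift 1 i).

Definition laurent_s (K : fieldType) (d : nat) : laurent_field K d :=
  FracField.tofrac 'X_(rshift d ord0).

Definition laurent_const (K : fieldType) (d : nat) (a : K) : laurent_field K d :=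
  FracField.tofrac a%:MP.

Definition toric_map (K : fieldType) (d n : nat) (M : 'M[int]_(d, n)) :
    {mpoly K[n]} -> laurent_field K d :=
  mmap (@laurent_const K d)
       (fun j => (\prod_(i < d) laurent_t K i ^ M i j) * laurent_s K d).

Definition toric_ideal (K : fieldType) (d n : nat) (M : 'M[int]_(d, n))
    (f : {mpoly K[n]}) : Prop :=
  toric_map M f = 0.

(* The zero column comes first, at index [zvar]; the former j-th column is at
   index [xvar j]. *)
Definition sharp (d n : nat) (M : 'M[int]_(d, n)) : 'M[int]_(d, 1 + n) :=
  row_mx 0 M.

Definition zvar (n : nat) : 'I_(1 + n) := lshift n ord0.
Definition xvar (n : nat) (j : 'I_n) : 'I_(1 + n) := rshift 1 j.

Definition var_order (n : nat) (lt : rel 'I_n) : Prop :=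
  [/\ irreflexive lt, transitive lt & forall i j, i != j -> lt i j || lt j i].

Definition revlex (n : nat) (lt : rel 'I_n) (u v : 'X_{1..n}) : bool :=
  (mdeg u < mdeg v)%N ||
  (mdeg u == mdeg v) &&
  [exists i, (v i < u i)%N && [forall j, lt j i ==> (u j == v j)]].

Definition initial_monomial (K : fieldType) (n : nat) (lt : rel 'I_n)
    (f : {mpoly K[n]}) (m : 'X_{1..n}) : Prop :=
  m \in msupp f /\ forall m', m' \in msupp f -> m' != m -> revlex lt m' m.

Definition initial_ideal (K : fieldType) (n : nat) (lt : rel 'I_n)
    (I : {mpoly K[n]} -> Prop) : {mpoly K[n]} -> Prop :=
  ideal_gen (fun g => exists f m,
    [/\ I f, f != 0, initial_monomial lt f m & g = 'X_[m]]).

Definition squarefree_monomial (n : nat) (m : 'X_{1..n}) : Prop :=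
  forall i, (m i <= 1)%N.

Definition squarefree_ideal (K : fieldType) (n : nat)
    (I : {mpoly K[n]} -> Prop) : Prop :=
  exists S : 'X_{1..n} -> Prop,
    (forall m, S m -> squarefree_monomial m) /\
    (forall f, I f <-> ideal_gen (fun g => exists2 m, S m & g = 'X_[m]) f).

Definition is_col (d n : nat) (c : 'cV[int]_d) (M : 'M[int]_(d, n)) : Prop :=
  exists j, c = col j M.

Definition pos_part (d : nat) (c : 'cV[int]_d) : 'cV[int]_d :=
  \col_i Num.max 0 (c i ord0).
Definition neg_part (d : nat) (c : 'cV[int]_d) : 'cV[int]_d :=
  \col_i Num.max 0 (- c i ord0).

Definition nonneg_mx (d n : nat) (M : 'M[int]_(d, n)) : Prop :=
  forall i j, 0 <= M i j.

Definition no_zero_col (d n : nat) (M : 'M[int]_(d, n)) : Prop :=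
  forall j, col j M != 0.

Definition of_harmony (d n m : nat) (A : 'M[int]_(d, n)) (B : 'M[int]_(d, m)) :
    Prop :=
  forall a b : 'cV[int]_d, is_col a (sharp A) -> is_col b (sharp B) ->
    is_col (pos_part (a - b)) (sharp A) /\ is_col (neg_part (a - b)) (sharp B).

(* Main.v *)
From HB Require Import structures.
Require Import Defs.
From mathcomp Require Import zify.

(** Membership of a monomial in the initial ideal of a toric ideal I_M is a
    combinatorial property of the columns of M.  Call two monomials fibre-mates when they have the
    same image under the toric map.  A monomial lies in the initial ideal
    exactly when it is not the least one of its fibre ([toric_ideal_cancel]: a
    polynomial of I_M cannot contain a single monomial of a fibre, since the
    images of different fibres are linearly independent; conversely, the
    difference of two fibre-mates lies in I_M, [toric_ideal_binomial]).  Hence the initial ideal is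
    squarefree if and only if each non-minimal monomial has a squarefree
    non-minimal divisor ([squarefree_initialP]), and the field disappears.

    On the variables of [-B, A]^# take z < x's < y's, the x's ordered by <_A and
    the y's by <_B.  Call a monomial standard when its (z, x)-part is minimal
    for A^#, its (z, y)-part is minimal for B^#, and it is divisible by no
    x_i y_j such that a_i and b_j have a common positive coordinate.

    A nonstandard monomial has a squarefree non-minimal divisor: for the first
    two conditions by the assumptions on A and B, for the third because harmony
    provides variables x_p and y_q (possibly z) for the columns c^(+) and c^(-),
    where c = a_i - b_j, and x_i y_j > x_p y_q since a_p is dominated by a_i
    ([harmony_swap]).

    Two standard monomials of one fibre are equal ([standard_uniq]).  In a
    standard monomial the exponent vectors contributed by the x's and by the
    y's have disjoint supports, so they are the positive and negative parts of
    the exponent vector of t and are determined by the fibre.  The x-parts of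
    the two monomials then have the same t-exponent, and after equalizing the
    degrees with the smallest variable z, minimality makes them equal
    ([fibre_min_eq]); likewise for the y-parts, and the degree determines the
    power of z.

    The least monomial of a fibre is therefore standard, and it is the only
    standard one; so a non-minimal monomial is nonstandard, and has a squarefree
    non-minimal divisor. *)

Set Implicit Arguments.
Unset Strict Implicit.
Unset Printing Implicit Defensive.

Import Order.TTheory GRing.Theory Num.Theory.
Local Open Scope ring_scope.

(** * Minimal elements and reverse lexicographic comparison *)

Lemma exists_minimal (T : finType) (r : rel T) (P : pred T) (x : T) :
  irreflexive r -> transitive r -> P x ->
  exists y, [/\ P y, (y == x) || r y x & forall z, P z -> ~~ r z y].
Proof.
move=> r_irr r_tr.
have [k] := ubnP #|[pred z | P z && r z x]|.
elim: k x => // k IHk x ltk Px.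
have [/existsP[y /andP[Py ryx]] | /pred0Pn no] := boolP [exists y, P y && r y x].
  have lt_y : (#|[pred z | P z && r z y]| < k)%N.
    apply: leq_trans (_ : _ <= #|[pred z | P z && r z x]|)%N _; last by [].
    apply: proper_card; apply/properP; split.
      apply/subsetP => z; rewrite !inE => /andP[-> rzy] /=.
      exact: r_tr rzy ryx.
    by exists y; rewrite !inE Py //= r_irr.
  have [z [Pz rzy zmin]] := IHk y lt_y Py; exists z; split=> //.
  by case/predU1P: rzy => [-> | /r_tr ->]; rewrite ?ryx ?orbT.
exists x; split; rewrite ?eqxx // => z Pz; apply/negP => rzx; apply: no.
by exists z; apply/andP.
Qed.

Section Revlex.

Variables (n : nat) (lt : rel 'I_n).
Implicit Types u v w c : 'X_{1..n}.

Lemma revlexDr c u v : revlex lt (u + c)%MM (v + c)%MM = revlex lt u v.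
Proof.
rewrite /revlex !mdegD ltn_add2r eqn_add2r; congr (_ || _ && _).
apply: eq_existsb => i; rewrite !mnmDE ltn_add2r; congr (_ && _).
by apply: eq_forallb => j; rewrite !mnmDE eqn_add2r.
Qed.

Hypothesis lt_order : var_order lt.

Lemma revlex_irr : irreflexive (revlex lt).
Proof.
move=> u; rewrite /revlex ltnn eqxx /=; apply/existsP => -[i].
by rewrite ltnn.
Qed.

Lemma revlex_trans : transitive (revlex lt).
Proof.
case: lt_order => _ lt_tr lt_tot v u w.
rewrite /revlex => /orP[uv|/andP[/eqP euv /existsP[i /andP[ui /forallP uvi]]]].
  case/orP=> [vw|/andP[/eqP <- _]]; last by rewrite uv.
  by rewrite (ltn_trans uv vw).
rewrite euv => /orP[-> // | /andP[-> /existsP[j /andP[vj /forallP vwj]]]].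
apply/orP; right => /=; apply/existsP.
have [eij | neq_ij] := eqVneq i j.
  subst j; exists i; rewrite (ltn_trans vj ui) /=; apply/forallP => k.
  apply/implyP => lki; have /implyP/(_ lki)/eqP-> := uvi k.
  by have /implyP/(_ lki)/eqP-> := vwj k.
case/orP: (lt_tot _ _ neq_ij) => [lij | lji].
  exists i; have /implyP/(_ lij)/eqP<- := vwj i; rewrite ui /=.
  apply/forallP => k; apply/implyP => lki.
  have /implyP/(_ lki)/eqP-> := uvi k.
  by have /implyP/(_ (lt_tr _ _ _ lki lij))/eqP-> := vwj k.
exists j; have /implyP/(_ lji)/eqP-> := uvi j; rewrite vj /=.
apply/forallP => k; apply/implyP => lkj.
have /implyP/(_ (lt_tr _ _ _ lkj lji))/eqP-> := uvi k.
by have /implyP/(_ lkj)/eqP-> := vwj k.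
Qed.

Lemma revlex_total u v : mdeg u = mdeg v -> u != v ->
  revlex lt u v || revlex lt v u.
Proof.
case: lt_order => lt_irr lt_tr lt_tot euv neq_uv.
have [i0 ui0] : exists i, u i != v i.
  apply/existsP; rewrite -negb_forall; apply: contra neq_uv => /forallP uv.
  by apply/eqP/mnmP => i; apply/eqP.
have [i [ui _ i_min]] := exists_minimal lt_irr lt_tr (P := fun i => u i != v i) ui0.
have below k : lt k i -> u k = v k.
  by move=> lki; apply: contraTeq lki => /i_min.
rewrite /revlex euv ltnn eqxx /=.
move: ui; rewrite neq_ltn => /orP[ui | ui]; apply/orP; [right | left];
  by apply/existsP; exists i; rewrite ui; apply/forallP => k; apply/implyP => /below->.
Qed.

End Revlex.

(** * Fibres of the toric map on monomials *)

Section Fibre.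

Variables (d n : nat) (M : 'M[int]_(d, n)).
Implicit Types u v w c : 'X_{1..n}.

(** The exponent of t_i in the image of the monomial x^u; the exponent of s is
    the total degree of u. *)
Definition tdeg u (i : 'I_d) : int := \sum_j M i j * (u j)%:Z.

Definition same_fibre u w : bool :=
  (mdeg u == mdeg w) && [forall i, tdeg u i == tdeg w i].

Lemma same_fibreP u w :
  reflect (mdeg u = mdeg w /\ tdeg u =1 tdeg w) (same_fibre u w).
Proof.
apply: (iffP andP) => -[].
  by move=> /eqP duw /forallP tuw; split=> // i; apply/eqP.
by move=> duw tuw; split; [apply/eqP | apply/forallP => i; apply/eqP].
Qed.

Lemma tdegD u v i : tdeg (u + v)%MM i = tdeg u i + tdeg v i.
Proof.
by rewrite -big_split; apply: eq_bigr => j _; rewrite mnmDE PoszD mulrDr.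
Qed.

Lemma tdeg1 j i : tdeg U_(j)%MM i = M i j.
Proof.
rewrite /tdeg (bigD1 j) //= mnm1E eqxx mulr1 big1 ?addr0 // => k /negbTE nkj.
by rewrite mnm1E eq_sym nkj mulr0.
Qed.

Lemma same_fibreDr c u v : same_fibre u v -> same_fibre (u + c)%MM (v + c)%MM.
Proof.
case/same_fibreP=> duv tuv; apply/same_fibreP; rewrite !mdegD duv.
by split=> // i; rewrite !tdegD tuv.
Qed.

Lemma same_fibre_sym u v : same_fibre u v = same_fibre v u.
Proof. by rewrite /same_fibre eq_sym; congr andb; apply: eq_forallb => i. Qed.

Lemma same_fibre_trans : transitive same_fibre.
Proof.
move=> v u w /same_fibreP[duv tuv] /same_fibreP[dvw tvw].
by apply/same_fibreP; rewrite duv; split=> // i; rewrite tuv.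
Qed.

Variable lt : rel 'I_n.

(** Fibre-mates have equal degree, so the search for a smaller one is finite;
    this makes non-minimality a decidable property. *)
Definition nonmin w : bool :=
  [exists u : 'X_{1..n < (mdeg w).+1}, same_fibre u w && revlex lt u w].

Lemma nonminP w :
  reflect (exists2 u, same_fibre u w & revlex lt u w) (nonmin w).
Proof.
apply: (iffP existsP) => [[u /andP[]] | [u uw ltuw]]; first by exists u.
have /same_fibreP[duw _] := uw.
have ltu : (mdeg u < (mdeg w).+1)%N by rewrite duw.
by exists (BMultinom ltu); rewrite uw.
Qed.

Lemma nonmin_le v w : (v <= w)%MM -> nonmin v -> nonmin w.
Proof.
move=> le_vw /nonminP[u uv ltuv]; apply/nonminP.
exists (u + (w - v))%MM; rewrite -{2}(submK le_vw) [((w - v) + v)%MM]addmC.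
  exact: same_fibreDr.
by rewrite revlexDr.
Qed.

Lemma exists_fibre_min w : var_order lt ->
  exists2 u, same_fibre u w & ~~ nonmin u.
Proof.
move=> lt_order.
pose T := 'X_{1..n < (mdeg w).+1}; pose bw : T := BMultinom (ltnSn (mdeg w)).
pose r := relpre (@bmnm n (mdeg w).+1) (revlex lt).
have r_irr : irreflexive r by move=> u; apply: revlex_irr.
have r_tr : transitive r by move=> v u x; apply: revlex_trans.
have Pw : same_fibre bw w by apply/same_fibreP.
have [u [uw _ u_min]] :=
  exists_minimal r_irr r_tr (P := fun u : T => same_fibre u w) Pw.
exists (val u) => //; apply/nonminP => -[v vu ltvu].
have vw := same_fibre_trans vu uw.
have /same_fibreP[dvw _] := vw.
have ltv : (mdeg v < (mdeg w).+1)%N by rewrite dvw.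
by have /negP := u_min (BMultinom ltv) vw.
Qed.

End Fibre.

(** * Initial ideals of toric ideals *)

Section ToricMap.

Variables (K : fieldType) (d n : nat) (M : 'M[int]_(d, n)).
Implicit Types (u v w : 'X_{1..n}) (f : {mpoly K[n]}).

Lemma laurent_t_neq0 (i : 'I_d) : laurent_t K i != 0.
Proof. by rewrite /laurent_t tofrac_eq0 -msupp_eq0 msuppX. Qed.

Lemma toric_monomial u :
  mmap1 (fun j => (\prod_(i < d) laurent_t K i ^ M i j) * laurent_s K d) u
  = (\prod_(i < d) laurent_t K i ^ tdeg M u i) * laurent_s K d ^+ mdeg u.
Proof.
rewrite /mmap1; under eq_bigr do rewrite exprMn -prodrXl.
rewrite big_split /= prodrXr -mdegE exchange_big /=; congr (_ * _).
apply: eq_bigr => i _.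
rewrite [RHS](big_morph _ (fun a b => expfzDr a b (laurent_t_neq0 i)) (expr0z _)).
by apply: eq_bigr => j _; rewrite -exprz_exp.
Qed.

Lemma toric_ideal_binomial u w : same_fibre M u w ->
  toric_ideal M ('X_[w] - 'X_[u] : {mpoly K[n]}).
Proof.
case/same_fibreP=> duw tuw; rewrite /toric_ideal /toric_map.
(* [mmapX] wants the embedding of the coefficients as a ring morphism. *)
have tfM : monoid_morphism (@laurent_const K d).
  by split=> [|a b]; rewrite /laurent_const ?mpolyC1 ?tofrac1 // mpolyCM tofracM.
have tfB : zmod_morphism (@laurent_const K d).
  by move=> a b; rewrite /laurent_const mpolyCB tofracB.
pose phiB := GRing.isZmodMorphism.Build _ _ _ tfB.
pose phiM := GRing.isMonoidMorphism.Build _ _ _ tfM.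
pose phi : {rmorphism K -> laurent_field K d} :=
  HB.pack (@laurent_const K d) phiB phiM.
rewrite -[@laurent_const K d]/(phi : K -> _) mmapB !mmapX !toric_monomial duw.
by under eq_bigr do rewrite -tuw; rewrite subrr.
Qed.

(** Distinct Laurent monomials are linearly independent, so the coefficients of
    an element of the toric ideal add up to 0 on each fibre, and no fibre
    meets its support in just one monomial.  Independence is seen in the
    polynomial ring, after multiplying by a power of t_1 ... t_d that clears
    all denominators. *)
Lemma toric_ideal_cancel f w : toric_ideal M f -> w \in msupp f ->
  exists u, [/\ u \in msupp f, u != w & same_fibre M u w].
Proof.
move=> If wf.
(* (t_1 ... t_d)^N clears the denominators of all monomials of the image. *)
pose N := (\sum_(u <- msupp f) \sum_(i < d) `|tdeg M u i|)%N.
have N_ge0 u i : u \in msupp f -> 0 <= tdeg M u i + N%:Z.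
  move=> uf; have leN : (`|tdeg M u i| <= N)%N.
    rewrite /N (bigD1_seq u) ?msupp_uniq //= (bigD1 i) //=.
    by rewrite -addnA leq_addr.
  lia.
pose e u : 'X_{1..d + 1} := [multinom match split k with
  | inl i => `|(tdeg M u i + N%:Z)%R|%N | inr _ => mdeg u end | k < d + 1].
have eL u i : e u (lshift 1 i) = `|(tdeg M u i + N%:Z)%R|%N.
  by rewrite mnmE (unsplitK (inl i)).
have eR u : e u (rshift d ord0) = mdeg u by rewrite mnmE (unsplitK (inr ord0)).
have eE u : u \in msupp f ->
    (\prod_(i < d) laurent_t K i ^ N%:Z) *
    mmap1 (fun j => (\prod_(i < d) laurent_t K i ^ M i j) * laurent_s K d) u
    = FracField.tofrac 'X_[e u].
  move=> uf; rewrite toric_monomial mulrA -big_split /= mpolyXE_id rmorph_prod.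
  rewrite big_split_ord /= big_ord1 eR rmorphXn; congr (_ * _).
  apply: eq_bigr => i _; rewrite eL rmorphXn -expfzDr ?laurent_t_neq0 //.
  by rewrite addrC -[in LHS](gez0_abs (N_ge0 u i uf)).
have e_fibre u : u \in msupp f -> e u = e w -> same_fibre M u w.
  move=> uf euw; apply/same_fibreP; split=> [|i]; first by rewrite -!eR euw.
  have := congr1 (fun v : 'X_{1..d + 1} => v (lshift 1 i)) euw; rewrite /= !eL.
  have := N_ge0 u i uf; have := N_ge0 w i wf; lia.
have G0 : \sum_(u <- msupp f) (f@_u)%:MP * 'X_[e u] = 0 :> {mpoly K[d + 1]}.
  apply/eqP; rewrite -tofrac_eq0 raddf_sum /=; apply/eqP.
  have := congr1 ( *%R (\prod_(i < d) laurent_t K i ^ N%:Z)) If.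
  rewrite mulr0 /toric_map /mmap mulr_sumr; apply: etrans.
  rewrite [LHS]big_seq [RHS]big_seq; apply: eq_bigr => u uf.
  by rewrite tofracM mulrCA eE.
have [/hasP[u uf /andP[nuw /eqP euw]] | /hasPn no] :=
  boolP (has (fun u => (u != w) && (e u == e w)) (msupp f)).
  by exists u; split=> //; apply: e_fibre.
have /eqP := congr1 (mcoeff (e w)) G0; rewrite mcoeff0 raddf_sum /=.
rewrite (bigD1_seq w) ?msupp_uniq //= mcoeffCM mcoeffX eqxx mulr1.
rewrite big_seq_cond big1 ?addr0 ?mcoeff_eq0 ?wf // => u /andP[uf nuw].
by have := no u uf; rewrite nuw /= mcoeffCM mcoeffX => /negbTE->; rewrite mulr0.
Qed.

End ToricMap.

Section IdealGen.

Variable R : comNzRingType.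
Implicit Types S : R -> Prop.

Lemma ideal_gen_in S f : S f -> ideal_gen S f.
Proof.
move=> Sf; exists [:: (1, f)]; split; last by rewrite big_seq1 mul1r.
by move=> p /[1!inE]/eqP->.
Qed.

Lemma ideal_genM S a f : ideal_gen S f -> ideal_gen S (a * f).
Proof.
case=> r [rS ->]; exists [seq (a * p.1, p.2) | p <- r]; split.
  by move=> _ /mapP[p pr ->] /=; apply: rS.
by rewrite big_map mulr_sumr; apply: eq_bigr => p _; rewrite mulrA.
Qed.

Lemma ideal_gen_sub S S' f : (forall g, S g -> ideal_gen S' g) ->
  ideal_gen S f -> ideal_gen S' f.
Proof.
move=> sub [r [rS ->]]; elim: r rS => [|p r IHr] rS.
  by exists [::]; split; rewrite ?big_nil.
have [r1 [r1S e1]] := IHr (fun q qr => rS q (mem_behead (s := p :: r) qr)).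
have [r2 [r2S e2]] := ideal_genM p.1 (sub _ (rS p (mem_head _ _))).
exists (r2 ++ r1); split; last by rewrite big_cons big_cat /= e1 e2.
by move=> q; rewrite mem_cat => /orP[/r2S | /r1S].
Qed.

End IdealGen.

Lemma mpolyX_inj (K : fieldType) n : injective (fun v => 'X_[v] : {mpoly K[n]}).
Proof.
move=> u v /(congr1 (mcoeff v)) /eqP.
by rewrite !mcoeffX eqxx; case: (eqVneq u v) => // _; rewrite eq_sym oner_eq0.
Qed.

(** Some summand of the representation of x^w must contain x^w itself. *)
Lemma monomial_ideal_mem (K : fieldType) n (S : {mpoly K[n]} -> Prop) w :
  (forall g, S g -> exists v, g = 'X_[v]) -> ideal_gen S 'X_[w] ->
  exists2 v, S 'X_[v] & (v <= w)%MM.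
Proof.
move=> Smon [r [rS /(congr1 (mcoeff w)) /eqP]].
rewrite mcoeffX eqxx raddf_sum /=.
have [/hasP[p pr cp] _ | /hasPn no] := boolP (has (fun p => (p.1 * p.2)@_w != 0) r).
  have [v pv] := Smon _ (rS p pr); exists v; first by rewrite -pv; apply: rS.
  move: cp; rewrite pv -mcoeff_msupp (perm_mem (msuppMX _ _)) => /mapP[u _ ->].
  exact: lem_addr.
rewrite big_seq big1 ?oner_eq0 // => p pr.
by apply/eqP; rewrite -[_ == _]negbK; apply: no.
Qed.

Section InitialIdeal.

Variables (K : fieldType) (d n : nat) (M : 'M[int]_(d, n)) (lt : rel 'I_n).

Lemma initial_nonmin (f : {mpoly K[n]}) w :
  toric_ideal M f -> initial_monomial lt f w -> nonmin M lt w.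
Proof.
move=> If [wf w_max]; have [u [uf nuw uw]] := toric_ideal_cancel If wf.
by apply/nonminP; exists u; last exact: w_max.
Qed.

Lemma nonmin_initial w : nonmin M lt w ->
  exists (f : {mpoly K[n]}) v,
    [/\ toric_ideal M f, f != 0, initial_monomial lt f v
      & 'X_[w] = 'X_[v] :> {mpoly K[n]}].
Proof.
case/nonminP=> u uw ltuw; have nuw : u != w.
  by apply: contraTneq ltuw => ->; rewrite revlex_irr.
have fw : ('X_[w] - 'X_[u] : {mpoly K[n]})@_w = 1.
  by rewrite mcoeffB !mcoeffX eqxx (negbTE nuw) subr0.
exists ('X_[w] - 'X_[u]), w; split=> //; first exact: toric_ideal_binomial.
  by apply: contra_eq_neq fw => ->; rewrite mcoeff0 eq_sym oner_eq0.
split=> [|v]; first by rewrite mcoeff_msupp fw oner_eq0.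
rewrite mcoeff_msupp mcoeffB !mcoeffX [w == v]eq_sym.
have [->//|nvw] := eqVneq v w; rewrite sub0r oppr_eq0.
by have [<-//|] := eqVneq u v; rewrite eqxx.
Qed.

(** The initial ideal is spanned by the non-minimal monomials, and a monomial
    lies in an ideal generated by monomials only as a multiple of one of
    them. *)
Lemma squarefree_initialP :
  squarefree_ideal (initial_ideal lt (@toric_ideal K d n M)) <->
  forall w, nonmin M lt w ->
    exists v, [/\ squarefree_monomial v, (v <= w)%MM & nonmin M lt v].
Proof.
have in_nonmin w : initial_ideal lt (@toric_ideal K d n M) 'X_[w] -> nonmin M lt w.
  case/monomial_ideal_mem=> [g [f [v [_ _ _ ->]]]|v]; first by exists v.
  by case=> f [u [If _ inu /mpolyX_inj->]] /nonmin_le; apply;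
    apply: initial_nonmin inu.
split.
  case=> S [S_sqf S_gen] w w_nonmin.
  have /S_gen : initial_ideal lt (@toric_ideal K d n M) 'X_[w].
    exact/ideal_gen_in/nonmin_initial.
  case/monomial_ideal_mem=> [g [v _ ->]|v [v' Sv' /mpolyX_inj ev] le_vw].
    by exists v.
  rewrite ev in le_vw; exists v'; split=> //; first exact: S_sqf.
  by apply/in_nonmin/S_gen/ideal_gen_in; exists v'.
move=> sqf; exists (fun v => squarefree_monomial v /\ nonmin M lt v).
split=> [v [] // | f]; split.
  apply: ideal_gen_sub => _ [g [v [Ig _ inv ->]]].
  have [u [u_sqf le_uv u_nonmin]] := sqf v (initial_nonmin Ig inv).
  by rewrite -(submK le_uv) mpolyXD; apply/ideal_genM/ideal_gen_in; exists u.
apply: ideal_gen_sub => _ [v [_ v_nonmin] ->].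
exact/ideal_gen_in/nonmin_initial.
Qed.

End InitialIdeal.

(** * Renaming variables *)

Section Pushforward.

Variables (p q : nat) (g : 'I_p -> 'I_q).

Definition pull (w : 'X_{1..q}) : 'X_{1..p} := [multinom w (g k) | k < p].

Definition push (v : 'X_{1..p}) : 'X_{1..q} :=
  [multinom (\sum_(k | g k == l) v k)%N | l < q].

Lemma mdeg_push v : mdeg (push v) = mdeg v.
Proof.
rewrite !mdegE (partition_big g predT) //=.
by apply: eq_bigr => l _; rewrite mnmE.
Qed.

Lemma tdeg_push d (N : 'M[int]_(d, q)) v i :
  tdeg N (push v) i = \sum_k N i (g k) * (v k)%:Z.
Proof.
rewrite (partition_big g predT) //=; apply: eq_bigr => l _.
rewrite mnmE (big_morph Posz PoszD (erefl _)) mulr_sumr.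
by apply: eq_bigr => k /eqP->.
Qed.

Hypothesis g_inj : injective g.

Lemma pushE v k : push v (g k) = v k.
Proof. by rewrite mnmE (big_pred1 k) // => j; rewrite /= (inj_eq g_inj). Qed.

Lemma push_cases v l :
  (exists2 k, l = g k & push v l = v k) \/ push v l = 0%N.
Proof.
have [/existsP[k /eqP gk] | no] := boolP [exists k, g k == l].
  by left; exists k; rewrite // -gk pushE.
right; rewrite mnmE big_pred0 // => k; apply/negbTE.
by apply: contra no => gk; apply/existsP; exists k.
Qed.

Lemma push_le v w : (v <= pull w)%MM -> (push v <= w)%MM.
Proof.
move=> /mnm_lepP le_v; apply/mnm_lepP => l.
by have [[k -> ->]|->//] := push_cases v l; have := le_v k; rewrite mnmE.
Qed.

Lemma push_squarefree v : squarefree_monomial v -> squarefree_monomial (push v).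
Proof. by move=> v_sqf l; have [[k _ ->]|->] := push_cases v l. Qed.

Variables (ltp : rel 'I_p) (ltq : rel 'I_q).
Hypothesis lt_g : forall a b, ltq (g a) (g b) = ltp a b.

Lemma revlex_push u v : revlex ltp u v -> revlex ltq (push u) (push v).
Proof.
rewrite /revlex !mdeg_push => /orP[-> //|].
case/andP=> -> /existsP[i /andP[lti /forallP eqi]].
apply/orP; right; apply/existsP; exists (g i); rewrite !pushE lti.
apply/forallP => l; apply/implyP => ltl.
have [/existsP[k /eqP gk] | no] := boolP [exists k, g k == l].
  by move: ltl; rewrite -gk lt_g !pushE => ltk; have := eqi k; rewrite ltk.
by rewrite !mnmE !big_pred0 // => k; apply/negbTE; apply: contra no => gk;
  apply/existsP; exists k.
Qed.

(** A sign in front of the columns does not change the fibres: this is how -B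
    inherits from B.  The variables outside the image of g have exponent 0 in
    both monomials, so the comparison is decided inside the image. *)
Lemma nonmin_push d (M : 'M[int]_(d, p)) (N : 'M[int]_(d, q)) (c : int) v :
  (forall i k, N i (g k) = c * M i k) ->
  nonmin M ltp v -> nonmin N ltq (push v).
Proof.
move=> NM /nonminP[u /same_fibreP[duv tuv] ltuv]; apply/nonminP.
exists (push u); last exact: revlex_push.
have tN w i : tdeg N (push w) i = c * tdeg M w i.
  by rewrite tdeg_push mulr_sumr; apply: eq_bigr => k _; rewrite NM mulrA.
by apply/same_fibreP; rewrite !mdeg_push; split=> // i; rewrite !tN tuv.
Qed.

End Pushforward.

(** * Minimal monomials when z is the smallest variable *)

Section Homogenize.

Variables (d n : nat) (M : 'M[int]_(d, n)) (lt : rel 'I_(1 + n)).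
Hypothesis lt_order : var_order lt.
Hypothesis lt_z : forall k, lt (zvar n) (xvar k).
Implicit Types u w : 'X_{1..1 + n}.

Lemma sharp_z i : sharp M i (zvar n) = 0.
Proof. by rewrite /sharp row_mxEl mxE. Qed.

Lemma sharp_x i j : sharp M i (xvar j) = M i j.
Proof. by rewrite /sharp row_mxEr. Qed.

Lemma var_cases (k : 'I_(1 + n)) : k = zvar n \/ exists j, k = xvar j.
Proof.
by case: (split_ordP k) => j ->; [left; rewrite (ord1 j) | right; exists j].
Qed.

Lemma xvar_neq_z j : (xvar j == zvar n) = false.
Proof. exact: eq_rlshift. Qed.

Lemma tdeg_sharp u i :
  tdeg (sharp M) u i = \sum_j M i j * (u (xvar j))%:Z.
Proof.
rewrite /tdeg big_split_ord big_ord1 /= sharp_z mul0r add0r.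
by apply: eq_bigr => j _; rewrite sharp_x.
Qed.

Lemma mdeg_sharp u : mdeg u = (u (zvar n) + \sum_j u (xvar j))%N.
Proof. by rewrite mdegE big_split_ord big_ord1. Qed.

Definition setz (e : nat) u : 'X_{1..1 + n} :=
  [multinom if k == zvar n then e else u k | k < 1 + n].

Lemma setz_z e u : setz e u (zvar n) = e.
Proof. by rewrite mnmE eqxx. Qed.

Lemma setz_x e u j : setz e u (xvar j) = u (xvar j).
Proof. by rewrite mnmE xvar_neq_z. Qed.

Lemma mdeg_setz e u : mdeg (setz e u) = (e + \sum_j u (xvar j))%N.
Proof. by rewrite mdeg_sharp setz_z; under eq_bigr do rewrite setz_x. Qed.

Lemma tdeg_setz e u i : tdeg (sharp M) (setz e u) i = tdeg (sharp M) u i.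
Proof. by rewrite !tdeg_sharp; apply: eq_bigr => j _; rewrite setz_x. Qed.

Lemma setz0_le u : (setz 0 u <= u)%MM.
Proof. by apply/mnm_lepP => k; rewrite mnmE; case: ifP. Qed.

(** The degrees may differ, but the zero column lets a power of z make up for the
    smaller degree.  As z is the smallest variable, a positive power of z would
    make that monomial the smaller one, against the minimality of the other. *)
Lemma fibre_min_eq u w :
  ~~ nonmin (sharp M) lt u -> ~~ nonmin (sharp M) lt w ->
  tdeg (sharp M) u =1 tdeg (sharp M) w ->
  forall j, u (xvar j) = w (xvar j).
Proof.
pose deg (v : 'X_{1..1 + n}) := (\sum_j v (xvar j))%N.
wlog le_uw : u w / (deg u <= deg w)%N => [gen | u_min w_min tuw].
  move=> u_min w_min tuw; case/orP: (leq_total (deg u) (deg w)) => [/gen|/gen H].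
    exact.
  by move=> j; apply/esym/H.
pose w0 := setz 0 w; pose v := setz (deg w - deg u) u.
have vw : same_fibre (sharp M) v w0.
  apply/same_fibreP; split=> [|i]; last by rewrite !tdeg_setz.
  by rewrite !mdeg_setz subnK.
have [evw j | nvw] := eqVneq v w0.
  by rewrite -(setz_x 0 w) -/w0 -evw setz_x.
have /same_fibreP[dvw _] := vw.
case/orP: (revlex_total lt_order dvw nvw) => [ltvw | ltwv].
  case/negP: w_min; apply: nonmin_le (setz0_le w) _.
  by apply/nonminP; exists v.
(* If w0 < v, the exponent of z in v cannot exceed the one in w0, which is 0; no
   power of z was then added, and w0 is a smaller fibre-mate of the x-part of
   u. *)
case/negP: u_min; apply: nonmin_le (setz0_le u) _.
suff ev : v = setz 0 u.
  by rewrite -ev; apply/nonminP; exists w0; rewrite // same_fibre_sym.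
move: ltwv; rewrite /revlex dvw ltnn eqxx /= => /existsP[i /andP[lti /forallP belowi]].
have vz : v (zvar n) = 0%N.
  have [ei | [j ej]] := var_cases i; first by move: lti; rewrite ei [w0 _]setz_z ltn0.
  by have := belowi (zvar n); rewrite ej lt_z [w0 _]setz_z => /eqP.
by move: vz; rewrite /v setz_z => ->.
Qed.

End Homogenize.

(** * The order on the variables of [-B, A]^# *)

Section Join.

Variables (d n m : nat) (A : 'M[int]_(d, n)) (B : 'M[int]_(d, m)).
Hypotheses (A_ge0 : nonneg_mx A) (B_ge0 : nonneg_mx B).
Hypothesis AB_harmony : of_harmony A B.
Variables (ltA : rel 'I_(1 + n)) (ltB : rel 'I_(1 + m)).
Hypotheses (ltA_order : var_order ltA) (ltB_order : var_order ltB).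
Hypothesis ltA_div : forall i j : 'I_n, i != j ->
  (forall k : 'I_d, A k i <= A k j) -> ltA (xvar i) (xvar j).
Hypothesis ltA_z : forall k : 'I_n, ltA (zvar n) (xvar k).
Hypothesis ltB_z : forall k : 'I_m, ltB (zvar m) (xvar k).

Let N : 'M[int]_(d, 1 + (m + n)) := sharp (row_mx (- B) A).

Definition embA (k : 'I_(1 + n)) : 'I_(1 + (m + n)) :=
  if split k is inr i then xvar (rshift m i) else zvar (m + n).

Definition embB (k : 'I_(1 + m)) : 'I_(1 + (m + n)) :=
  if split k is inr j then xvar (lshift n j) else zvar (m + n).

(** The three groups of variables z, y and x, in the order of the columns of
    [-B, A]^#. *)
Definition split3 (k : 'I_(1 + (m + n))) : 'I_1 + ('I_m + 'I_n) :=
  match split k with inl o => inl o | inr l => inr (split l) end.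

(** The order z < x's < y's: with the x's below the y's, x_i y_j and x_p y_q are
    compared through x_i and x_p, about which <_A is known to respect
    divisibility. *)
Definition sum_lt (s t : 'I_1 + ('I_m + 'I_n)) : bool :=
  match s, t with
  | inr (inr i), inr (inr i') => ltA (xvar i) (xvar i')
  | inr (inl j), inr (inl j') => ltB (xvar j) (xvar j')
  | inl _, inr _ | inr (inr _), inr (inl _) => true
  | _, _ => false
  end.

Definition join_lt : rel 'I_(1 + (m + n)) := relpre split3 sum_lt.

Lemma embA_z : embA (zvar n) = zvar (m + n).
Proof. by rewrite /embA (unsplitK (inl ord0)). Qed.
Lemma embA_x i : embA (xvar i) = xvar (rshift m i).
Proof. by rewrite /embA (unsplitK (inr i)). Qed.
Lemma embB_z : embB (zvar m) = zvar (m + n).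
Proof. by rewrite /embB (unsplitK (inl ord0)). Qed.
Lemma embB_x j : embB (xvar j) = xvar (lshift n j).
Proof. by rewrite /embB (unsplitK (inr j)). Qed.

Lemma split3_z : split3 (zvar (m + n)) = inl ord0.
Proof. by rewrite /split3 (unsplitK (inl ord0)). Qed.
Lemma split3_A i : split3 (xvar (rshift m i)) = inr (inr i).
Proof. by rewrite /split3 (unsplitK (inr _)) (unsplitK (inr i)). Qed.
Lemma split3_B j : split3 (xvar (lshift n j)) = inr (inl j).
Proof. by rewrite /split3 (unsplitK (inr _)) (unsplitK (inl j)). Qed.

Lemma split3_inj : injective split3.
Proof.
apply: (can_inj (g := fun s => match s with
  | inl _ => zvar (m + n)
  | inr (inl j) => xvar (lshift n j) | inr (inr i) => xvar (rshift m i) end)).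
move=> k; have [->|[l ->]] := var_cases k; first by rewrite split3_z.
by case: (split_ordP l) => j ->; rewrite ?split3_A ?split3_B.
Qed.

Lemma join_var_cases k :
  [\/ k = zvar (m + n), exists j, k = embB (xvar j) | exists i, k = embA (xvar i)].
Proof.
have [->|[l ->]] := var_cases k; first by constructor 1.
case: (split_ordP l) => j ->; first by constructor 2; exists j; rewrite embB_x.
by constructor 3; exists j; rewrite embA_x.
Qed.

Lemma ltA_Nz k : ltA k (zvar n) = false.
Proof.
case: ltA_order => irr tr _; apply/negP => ltk.
have [ek|[i ek]] := var_cases k; first by rewrite ek irr in ltk.
by have := tr _ _ _ ltk (ltA_z i); rewrite -ek irr.
Qed.

Lemma ltB_Nz k : ltB k (zvar m) = false.
Proof.
case: ltB_order => irr tr _; apply/negP => ltk.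
have [ek|[i ek]] := var_cases k; first by rewrite ek irr in ltk.
by have := tr _ _ _ ltk (ltB_z i); rewrite -ek irr.
Qed.

Lemma join_lt_embA a b : join_lt (embA a) (embA b) = ltA a b.
Proof.
rewrite /join_lt /=.
have [->|[i ->]] := var_cases a; have [->|[j ->]] := var_cases b;
  by rewrite ?embA_z ?embA_x ?split3_z ?split3_A /= ?ltA_z ?ltA_Nz.
Qed.

Lemma join_lt_embB a b : join_lt (embB a) (embB b) = ltB a b.
Proof.
rewrite /join_lt /=.
have [->|[i ->]] := var_cases a; have [->|[j ->]] := var_cases b;
  by rewrite ?embB_z ?embB_x ?split3_z ?split3_B /= ?ltB_z ?ltB_Nz.
Qed.

Lemma join_lt_order : var_order join_lt.
Proof.
case: ltA_order => irrA trA totA; case: ltB_order => irrB trB totB; split.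
- by move=> k; rewrite /join_lt /=; case: (split3 k) => [|[]] //=.
- move=> k l r; rewrite /join_lt /=.
  case: (split3 k) (split3 l) (split3 r) => [?|[?|?]] [?|[?|?]] [?|[?|?]] //=;
    [exact: trB | exact: trA].
move=> k l; rewrite -(inj_eq split3_inj) /join_lt /=.
case: (split3 k) (split3 l) => [o|[j|i]] [o'|[j'|i']] //= nkl.
- by rewrite (ord1 o) (ord1 o') eqxx in nkl.
- by apply: totB; apply: contraNneq nkl => /rshift_inj->.
- by apply: totA; apply: contraNneq nkl => /rshift_inj->.
Qed.

Lemma join_lt_z k : k != zvar (m + n) -> join_lt (zvar (m + n)) k.
Proof.
have [->|[j ->]|[i ->]] := join_var_cases k; rewrite ?eqxx // => _;
  by rewrite -?embA_z ?join_lt_embA // embA_z -embB_z join_lt_embB.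
Qed.

Lemma embA_inj : injective embA.
Proof.
move=> a b; have [->|[i ->]] := var_cases a; have [->|[j ->]] := var_cases b => //;
  by move/(congr1 split3); rewrite ?embA_z ?embA_x ?split3_z ?split3_A // => -[->].
Qed.

Lemma embB_inj : injective embB.
Proof.
move=> a b; have [->|[i ->]] := var_cases a; have [->|[j ->]] := var_cases b => //;
  by move/(congr1 split3); rewrite ?embB_z ?embB_x ?split3_z ?split3_B // => -[->].
Qed.

Lemma join_colA i k : N i (embA k) = 1 * sharp A i k.
Proof.
rewrite mul1r; have [->|[j ->]] := var_cases k; first by rewrite embA_z !sharp_z.
by rewrite embA_x !sharp_x row_mxEr.
Qed.

Lemma join_colB i k : N i (embB k) = -1 * sharp B i k.
Proof.
rewrite mulN1r; have [->|[j ->]] := var_cases k; first by rewrite embB_z !sharp_z oppr0.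
by rewrite embB_x !sharp_x row_mxEl mxE.
Qed.

Lemma tdeg_join w i :
  tdeg N w i = tdeg (sharp A) (pull embA w) i - tdeg (sharp B) (pull embB w) i.
Proof.
rewrite !tdeg_sharp big_split_ord /= addrC; congr (_ + _).
  by apply: eq_bigr => j _; rewrite row_mxEr mnmE embA_x.
by rewrite -sumrN; apply: eq_bigr => j _; rewrite row_mxEl mxE mnmE embB_x mulNr.
Qed.

(** * Standard monomials *)

Definition overlap (w : 'X_{1..1 + (m + n)}) : bool :=
  [exists i, [exists j, [exists k,
    [&& 0 < A k i, 0 < B k j, w (embA (xvar i)) != 0%N
      & w (embB (xvar j)) != 0%N]]]].

Definition standard w : bool :=
  [&& ~~ overlap w, ~~ nonmin (sharp A) ltA (pull embA w)
    & ~~ nonmin (sharp B) ltB (pull embB w)].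

Lemma tdeg_ge0 p (M : 'M[int]_(d, p)) u i : nonneg_mx M -> 0 <= tdeg (sharp M) u i.
Proof.
by move=> M_ge0; rewrite tdeg_sharp sumr_ge0 // => j _; rewrite mulr_ge0.
Qed.

Lemma tdeg_support p (M : 'M[int]_(d, p)) u i : nonneg_mx M ->
  tdeg (sharp M) u i != 0 -> exists2 j, 0 < M i j & u (xvar j) != 0%N.
Proof.
move=> M_ge0; rewrite tdeg_sharp => nz.
have [/existsP[j /andP[Mj uj]]|no] :=
  boolP [exists j, (0 < M i j) && (u (xvar j) != 0%N)]; first by exists j.
case/eqP: nz; rewrite big1 // => j _; apply/eqP; rewrite mulf_eq0.
apply: contraR no; rewrite negb_or => /andP[Mj uj].
by apply/existsP; exists j; rewrite lt_def Mj M_ge0.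
Qed.

(** Where both parts contributed to t_i, a variable of each would have a
    positive i-th coordinate, and these two would overlap. *)
Lemma tdeg_disjoint w i : ~~ overlap w ->
  tdeg (sharp A) (pull embA w) i = 0 \/ tdeg (sharp B) (pull embB w) i = 0.
Proof.
move=> no; have [->|nA] := eqVneq (tdeg (sharp A) (pull embA w) i) 0; first by left.
right; apply/eqP; apply: contraNT no => nB.
have [a Aa wa] := tdeg_support A_ge0 nA; have [b Bb wb] := tdeg_support B_ge0 nB.
apply/existsP; exists a; apply/existsP; exists b; apply/existsP; exists i.
by move: wa wb; rewrite !mnmE Aa Bb => -> ->.
Qed.

(** From a - b and ab = 0 with a, b >= 0 one recovers a and b; so the fibre
    determines the t-exponents of both parts, and [fibre_min_eq] applies. *)
Lemma standard_uniq u w : standard u -> standard w -> same_fibre N u w -> u = w.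
Proof.
case/and3P=> uO uA uB /and3P[wO wA wB] /same_fibreP[duw tuw].
have tAB i : tdeg (sharp A) (pull embA u) i = tdeg (sharp A) (pull embA w) i
          /\ tdeg (sharp B) (pull embB u) i = tdeg (sharp B) (pull embB w) i.
  have := tuw i; rewrite !tdeg_join.
  have := tdeg_ge0 (pull embA u) i A_ge0; have := tdeg_ge0 (pull embA w) i A_ge0.
  have := tdeg_ge0 (pull embB u) i B_ge0; have := tdeg_ge0 (pull embB w) i B_ge0.
  have := tdeg_disjoint i uO; have := tdeg_disjoint i wO; lia.
have eA i : u (embA (xvar i)) = w (embA (xvar i)).
  have := fibre_min_eq ltA_order ltA_z uA wA (fun i => proj1 (tAB i)) i.
  by rewrite !mnmE.
have eB j : u (embB (xvar j)) = w (embB (xvar j)).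
  have := fibre_min_eq ltB_order ltB_z uB wB (fun i => proj2 (tAB i)) j.
  by rewrite !mnmE.
apply/mnmP => k; have [->|[j ->]|[i ->]] := join_var_cases k => //.
move: duw; rewrite !mdeg_sharp; rewrite (eq_bigr (fun l => w (xvar l))).
  by move/addIn.
by move=> l _; case: (split_ordP l) => a ->; rewrite -?embA_x -?embB_x.
Qed.

(** With p and q the columns that harmony provides for c = a_i - b_j, the
    smaller fibre-mate is x_p y_q.  The column p is dominated by a_i because
    c^(+) <= a_i, and differs from it because both a_i and b_j are positive at
    k; hence p precedes i. *)
Lemma harmony_swap i j k : 0 < A k i -> 0 < B k j ->
  nonmin N join_lt (U_(embA (xvar i)) + U_(embB (xvar j)))%MM.
Proof.
move=> Aki Bkj.
have colA : is_col (col i A) (sharp A).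
  by exists (xvar i); apply/colP => l; rewrite [LHS]mxE [RHS]mxE sharp_x.
have colB : is_col (col j B) (sharp B).
  by exists (xvar j); apply/colP => l; rewrite [LHS]mxE [RHS]mxE sharp_x.
have [[p /colP ep] [q /colP eq]] := AB_harmony colA colB.
have pE l : sharp A l p = Num.max 0 (A l i - B l j).
  by have := ep l; rewrite [col _ _ _ _ in RHS]mxE => <-; rewrite !mxE.
have qE l : sharp B l q = Num.max 0 (- (A l i - B l j)).
  by have := eq l; rewrite [col _ _ _ _ in RHS]mxE => <-; rewrite !mxE.
have ltp : ltA p (xvar i).
  move: pE; have [-> _ | [i' ->] pE] := var_cases p; first exact: ltA_z.
  apply: ltA_div => [|l].
    by apply: contraTneq Aki => ei; have := pE k; rewrite sharp_x ei; lia.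
  by have := pE l; have := B_ge0 l j; have := A_ge0 l i; rewrite sharp_x; lia.
apply/nonminP; exists (U_(embA p) + U_(embB q))%MM.
  apply/same_fibreP; rewrite !mdegD !mdeg1; split=> // l.
  rewrite !tdegD !tdeg1 !join_colA !join_colB pE qE !sharp_x; lia.
rewrite /revlex !mdegD !mdeg1 ltnn eqxx /=; apply/existsP.
case: (join_lt_order) => irr tr tot.
have ltpA : join_lt (embA p) (embA (xvar i)) by rewrite join_lt_embA.
have ltAB i' j' : join_lt (embA (xvar i')) (embB (xvar j')).
  by rewrite embA_x embB_x /join_lt /= split3_A split3_B.
have ltpB : join_lt (embA p) (embB (xvar j)) := tr _ _ _ ltpA (ltAB i j).
have neq a b : join_lt a b -> (b == a) = false.
  by move=> ltab; apply: contraTF ltab => /eqP->; rewrite irr.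
have small a : join_lt a (embA p) -> forall b, join_lt (embA p) b -> (b == a) = false.
  by move=> lta b ltb; apply: neq; apply: tr lta ltb.
(* The deciding variable is the smaller one of p and q: z if q is the zero
   column, and p otherwise, since every x precedes every y. *)
have [eqz | [j' eqx]] := var_cases q.
  exists (embB q); have ltz b : b != zvar (m + n) -> join_lt (embB q) b.
    by rewrite eqz embB_z; apply: join_lt_z.
  have xz a : embA (xvar a) != zvar (m + n) by rewrite embA_x xvar_neq_z.
  have yz b : embB (xvar b) != zvar (m + n) by rewrite embB_x xvar_neq_z.
  rewrite !mnmDE !mnm1E eqxx [embA (xvar i) == _]neq ?[embB (xvar j) == _]neq
    ?ltz //= addn1 /=.
  apply/forallP => a; apply/implyP; rewrite eqz embB_z.
  have [->|na] := eqVneq a (zvar (m + n)); first by rewrite irr.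
  by move=> /(tr _ _ _) /(_ (join_lt_z na)); rewrite irr.
exists (embA p); rewrite !mnmDE !mnm1E eqxx (neq _ _ ltpA) (neq _ _ ltpB) /=.
apply/forallP => a; apply/implyP => lta; rewrite !mnmDE !mnm1E.
rewrite (small _ lta _ ltpA) (small _ lta _ ltpB) (neq _ _ lta).
by rewrite eqx (small _ lta) // (tr _ _ _ ltpA).
Qed.

Lemma overlap_nonmin w : overlap w ->
  exists v, [/\ squarefree_monomial v, (v <= w)%MM & nonmin N join_lt v].
Proof.
case/existsP=> i /existsP[j /existsP[k /and4P[Aki Bkj wi wj]]].
have nAB : embA (xvar i) != embB (xvar j).
  by rewrite -(inj_eq split3_inj) embA_x embB_x split3_A split3_B.
exists (U_(embA (xvar i)) + U_(embB (xvar j)))%MM; split; last exact: harmony_swap Aki Bkj.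
  move=> l; rewrite mnmDE !mnm1E; move: nAB.
  by have [<- /negbTE|_ _] := eqVneq (embA (xvar i)) l; [rewrite eq_sym => -> | case: eqP].
apply/mnm_lepP => l; rewrite mnmDE !mnm1E.
have [<-|_] := eqVneq (embA (xvar i)) l; first by rewrite eq_sym (negbTE nAB) addn0 lt0n.
by have [<-|_] := eqVneq (embB (xvar j)) l; rewrite ?lt0n.
Qed.

Hypothesis sqfA : forall w, nonmin (sharp A) ltA w ->
  exists v, [/\ squarefree_monomial v, (v <= w)%MM & nonmin (sharp A) ltA v].
Hypothesis sqfB : forall w, nonmin (sharp B) ltB w ->
  exists v, [/\ squarefree_monomial v, (v <= w)%MM & nonmin (sharp B) ltB v].

Lemma nonstandard_nonmin w : ~~ standard w ->
  exists v, [/\ squarefree_monomial v, (v <= w)%MM & nonmin N join_lt v].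
Proof.
rewrite !negb_and !negbK => /or3P[/overlap_nonmin // | /sqfA | /sqfB]
  [v [v_sqf le_v v_nonmin]].
  exists (push embA v); split.
  - exact: push_squarefree embA_inj _ v_sqf.
  - exact: push_le embA_inj _ _ le_v.
  exact: (nonmin_push embA_inj join_lt_embA join_colA).
exists (push embB v); split.
- exact: push_squarefree embB_inj _ v_sqf.
- exact: push_le embB_inj _ _ le_v.
exact: (nonmin_push embB_inj join_lt_embB join_colB).
Qed.

(** If the given monomial were standard, it would coincide with the least
    monomial of its fibre, which is standard as well. *)
Lemma join_squarefree w : nonmin N join_lt w ->
  exists v, [/\ squarefree_monomial v, (v <= w)%MM & nonmin N join_lt v].
Proof.
move=> w_nonmin; apply: nonstandard_nonmin; apply/negP => w_std.
have [u uw u_min] := exists_fibre_min N w join_lt_order.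
have u_std : standard u.
  apply: contraNT u_min => /nonstandard_nonmin[v [_ le_vu]].
  exact: nonmin_le.
by rewrite (standard_uniq u_std w_std uw) w_nonmin in u_min.
Qed.

End Join.

Theorem theorem1p1 (K : fieldType) (d n m : nat)
    (A : 'M[int]_(d, n)) (B : 'M[int]_(d, m))
    (A_ge0 : nonneg_mx A) (B_ge0 : nonneg_mx B)
    (A_col_neq0 : no_zero_col A) (B_col_neq0 : no_zero_col B)
    (AB_harmony : of_harmony A B)
    (ltA : rel 'I_(1 + n)) (ltB : rel 'I_(1 + m))
    (ltA_order : var_order ltA) (ltB_order : var_order ltB)
    (inA_squarefree :
       squarefree_ideal (initial_ideal ltA (@toric_ideal K d _ (sharp A))))
    (inB_squarefree :
       squarefree_ideal (initial_ideal ltB (@toric_ideal K d _ (sharp B))))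
    (ltA_div : forall i j : 'I_n, i != j ->
       (forall k : 'I_d, A k i <= A k j) -> ltA (xvar i) (xvar j))
    (ltA_z : forall k : 'I_n, ltA (zvar n) (xvar k))
    (ltB_z : forall k : 'I_m, ltB (zvar m) (xvar k)) :
  exists lt : rel 'I_(1 + (m + n)),
    [/\ var_order lt,
        forall k : 'I_(1 + (m + n)), k != zvar (m + n) -> lt (zvar (m + n)) k
      & squarefree_ideal
          (initial_ideal lt (@toric_ideal K d _ (sharp (row_mx (- B) A))))].
Proof.
exists (join_lt ltA ltB); split.
- exact: join_lt_order.
- by move=> k; apply: join_lt_z.
apply/squarefree_initialP; apply: join_squarefree => //.
  exact/squarefree_initialP/inA_squarefree.
exact/squarefree_initialP/inB_squarefree.
Qed.
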